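(* Consider a set $S=\{x_i\}_{i=1}^N$ of $N$ i.i.d. samples from a distribution $\mathcal{X}$ on $\mathbf{R}^d$. Let the prior mean $w_0\in\mathbf{R}^p$ and the prior variance hyperparameters $\lambda^{\max}>0$ and $b>0$ be independent of the samples. Then for any $\delta\in(0,1)$, any posterior distribution $\mathcal{N}_{w,s}=\mathcal{N}(w,\mathrm{diag}(s))$ (with $w\in\mathbf{R}^p$, $s\in\mathbf{R}^p_+$), and any vector $a=(a_1,\dots,a_J)$ of positive integers, with probability at least $1-\delta$ the following bound holds: $$R_{\mathcal{X}}(\mathcal{N}_{w,s})\;\le\;\mathrm{kl}^{-1}\bigl(\hat R_S(\mathcal{N}_{w,s})\,\big|\,B(w,s,\lambda)\bigr).$$ Here $\lambda=\lambda^{\max}\exp(-a/b)$, i.e. $\lambda_j=\lambda^{\max}\exp(-a_j/b)$ for $j=1,\dots,J$, and the regularization term is $$B(w,s,\lambda)=\frac1N\left(\mathrm{KL}\bigl(\mathcal{N}_{w,s}\,\|\,\mathcal{N}(w_0,\Lambda)\bigr)+\sum_{j=1}^J 2\log\Bigl(b\log\frac{\lambda^{\max}}{\lambda_j}\Bigr)+J\log\frac{\pi^2}{6}+\log\frac{2\sqrt N}{\delta}\right),$$ where $\Lambda$ is the diagonal matrix built from $\lambda$ as described in the context.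
   Context: Setting: a learned optimizer with weights $\theta\in\mathbf{R}^p$ produces, for each problem parameter $x\in\mathbf{R}^d$, an output $z_\theta^k(x)\in\mathbf{R}^n$ after a fixed number $k$ of algorithm steps. For a real-valued performance metric $\phi$ and a tolerance $\epsilon$, the 0--1 error is $e_\theta(x)=\mathbf{1}\bigl(\phi(z_\theta^k(x),x)\ge\epsilon\bigr)\in\{0,1\}$. For a probability distribution $P$ on $\mathbf{R}^p$, the expected risk is $R_{\mathcal{X}}(P)=\mathbf{E}_{\theta\sim P}\mathbf{E}_{x\sim\mathcal{X}}\,e_\theta(x)$, and the expected empirical risk is $\hat R_S(P)=\mathbf{E}_{\theta\sim P}\frac1N\sum_{i=1}^N e_\theta(x_i)$. The weight indices $\{1,\dots,p\}$ are partitioned into $J$ groups $\mathcal{I}_1,\dots,\mathcal{I}_J$. Given $\lambda\in\mathbf{R}^J_+$, the prior covariance $\Lambda$ is the $p\times p$ diagonal matrix whose diagonal entries with index in $\mathcal{I}_j$ all equal $\lambda_j$, for $j=1,\dots,J$. For $q,r\in[0,1]$, $\mathrm{kl}(q\,\|\,r)=q\log\frac{q}{r}+(1-q)\log\frac{1-q}{1-r}$ is the Kullback--Leibler divergence between Bernoulli distributions with means $q$ and $r$, and for $c>0$, $\mathrm{kl}^{-1}(q\,|\,c)=\sup\{r\in[0,1] : \mathrm{kl}(q\,\|\,r)\le c\}$. $\mathrm{KL}(Q\,\|\,P)$ denotes the Kullback--Leibler divergence between probability distributions on $\mathbf{R}^p$. The probability is over the draw of $S$. *)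

(* Defs.v *)
(* R^n is [n.-tuple R] with the library's product sigma-algebra, generated by the
   coordinate projections. *)
From HB Require Import structures.
From mathcomp Require Import all_boot all_order all_algebra.
From mathcomp Require Import all_classical all_reals all_analysis.

Set Implicit Arguments.
Unset Strict Implicit.
Unset Printing Implicit Defensive.

Import Order.TTheory GRing.Theory Num.Theory.

Local Open Scope classical_set_scope.
Local Open Scope ring_scope.

Section gaussian.
Context {R : realType}.

(* N(m, v), with v the variance.  The library's [normal_prob] takes the standard
   deviation and is a junk distribution when that is 0, hence the Dirac case.
   It lives on [measurableTypeR R], the real line R with the same Borel sets as
   the default structure on R but another display. *)
Definition normal1 (m v : R) : probability (measurableTypeR R) R :=
  if v == 0 then dirac (m : measurableTypeR R) : probability _ R
  else normal_prob m (Num.sqrt v) : probability _ R.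

Definition tcons n (x : measurableTypeR R * n.-tuple R) : n.+1.-tuple R :=
  [tuple of (x.1 : R) :: x.2].

Lemma measurable_tcons n :
  measurable_fun [set: measurableTypeR R * n.-tuple R] (@tcons n).
Proof.
apply: (measurable_cons (f := fun x => x.1 : R)) => //.
exact: measurable_fst.
Qed.

HB.instance Definition _ n :=
  isMeasurableFun.Build _ _ (measurableTypeR R * n.-tuple R)%type
    (n.+1.-tuple R) (@tcons n) (@measurable_tcons n).

(* N(m, diag(v)) on R^n, as the product of the N(m_i, v_i). *)
Fixpoint normal_diag n :
    ('I_n -> R) -> ('I_n -> R) -> probability (n.-tuple R) R :=
  match n with
  | 0 => fun _ _ => \d_[tuple]
  | n'.+1 => fun m v =>
      distribution
        (normal1 (m ord0) (v ord0) \x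
           normal_diag (fun i => m (lift ord0 i)) (fun i => v (lift ord0 i)))%E
        (@tcons n')
  end.

End gaussian.

Section divergences.
Context {R : realType}.
Local Open Scope ereal_scope.

(* [charge_of_finite_measure] only recasts Q as a charge, the type expected by
   the Radon-Nikodym derivative. *)
Definition KL d (T : measurableType d) (Q P : probability T R) : \bar R :=
  if `[< Q `<< P >] then
    \int[Q]_t (ln (fine (Radon_Nikodym (charge_of_finite_measure Q) P t)))%:E
  else +oo.

(* a log(a / b), with 0 log(0 / b) = 0 and a log(a / 0) = +oo for a > 0; these
   conventions are needed since [a / 0 = 0] and [ln 0 = 0] in the library. *)
Definition kl_term (a b : R) : \bar R :=
  if a == 0%R then 0 else if b == 0%R then +oo else (a * ln (a / b))%:E.

Definition kl (q r : R) : \bar R := kl_term q r + kl_term (1 - q) (1 - r).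

(* The bound c may be +oo, as happens when a divergence is infinite. *)
Definition kl_inv (q : R) (c : \bar R) : R :=
  sup [set r : R | (0 <= r <= 1)%R /\ kl q r <= c].

End divergences.

Section iid.
Local Open Scope ereal_scope.
Context {R : realType} d (Omega : measurableType d) (P : probability Omega R).
Context d' (T : measurableType d') (N : nat) (X : 'I_N -> {RV P >-> T}).

Definition mutually_independent : Prop :=
  forall (K : {set 'I_N}) (A : 'I_N -> set T),
    (forall i, measurable (A i)) ->
    P (\bigcap_(i in [set` K]) (X i @^-1` A i)) =
    \prod_(i in K) P (X i @^-1` A i).

Definition iid_samples (D : probability T R) : Prop :=
  (forall i (A : set T), measurable A -> distribution P (X i) A = D A) /\
  mutually_independent.

End iid.

Section risks.
Context {R : realType} (p d n : nat).
Variables (phi : n.-tuple R -> d.-tuple R -> R) (eps : R).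
Variable zk : p.-tuple R -> d.-tuple R -> n.-tuple R.

Definition err (theta : p.-tuple R) (x : d.-tuple R) : R :=
  (eps <= phi (zk theta x) x)%R%:R.

Definition expected_risk (D : probability (d.-tuple R) R)
    (P : probability (p.-tuple R) R) : R :=
  \int[P]_theta \int[D]_x err theta x.

Definition empirical_risk N (S : 'I_N -> d.-tuple R)
    (P : probability (p.-tuple R) R) : R :=
  \int[P]_theta (N%:R^-1 * \sum_(i < N) err theta (S i)).

End risks.

(* The partition {I_j} of the weight indices is given by the map [grp] sending
   an index to its group, I_j = grp^-1(j); this is the diagonal of Lambda. *)
Definition prior_variance (R : realType) (p J : nat) (grp : 'I_p -> 'I_J)
    (lambda : 'I_J -> R) : 'I_p -> R :=
  fun i => lambda (grp i).

Definition regularizer (R : realType) (p J N : nat) (grp : 'I_p -> 'I_J)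
    (w0 : p.-tuple R) (lmax b delta : R)
    (w s : p.-tuple R) (lambda : 'I_J -> R) : \bar R :=
  ((N%:R^-1)%:E *
   (KL (normal_diag (tnth w) (tnth s))
       (normal_diag (tnth w0) (prior_variance grp lambda)) +
    ((\sum_(j < J) 2 * ln (b * ln (lmax / lambda j)))
     + J%:R * ln (pi ^+ 2 / 6)
     + ln (2 * Num.sqrt N%:R / delta))%:E))%E.

(* Main.v *)
(* Write r_t for the error probability of the weights t and k_t for the number of
   errors they make on the sample.  For fixed t the likelihood ratio
   exp(N kl(k_t/N || r_t)) has expectation at most
   sum_k C(N,k) (k/N)^k (1-k/N)^(N-k), which Abel's identity rewrites as
   sum_j N(N-1)...(N-j+1)/N^j <= 2 sqrt N.  Tonelli and Markov bound its average
   over a prior, except on an event of small probability.  These events are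
   summed over the priors indexed by the integer vectors a, with weights
   prod_j 6/(pi^2 a_j^2) of total mass at most 1.  Off the exceptional event, the
   Donsker-Varadhan inequality transfers the bound to every posterior, applied
   to an affine minorant of N kl(k_t/N || r_t), so that no joint convexity of kl
   is needed and only bounded functions occur. *)
Require Import Defs.
From HB Require Import structures.
From mathcomp Require Import all_boot all_order all_algebra.
From mathcomp Require Import all_classical all_reals all_analysis.
From mathcomp Require Import measurable_realfun ring lra zify.

Set Implicit Arguments.
Unset Strict Implicit.
Unset Printing Implicit Defensive.

Import Order.TTheory GRing.Theory Num.Theory.

Local Open Scope classical_set_scope.
Local Open Scope ring_scope.

(** * Abel's identity and Maurer's constant *)

(** An n-th finite difference annihilates lower powers. Splitting off one factor [x + i] leaves a
    term that vanishes by induction and one where absorbing [i] into the binomial coefficient lowers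
    [m] and [n] and moves the base point to [x + 1]; hence the generalization over [n] and [x]. *)
Lemma alternating_binomial_sum_power (R : comNzRingType) (m n : nat) (x : R) :
  (m <= n)%N ->
  \sum_(i < n.+1) (-1) ^+ (n - i) * (x + i%:R) ^+ m *+ 'C(n, i) =
  (m == n)%:R * n`!%:R.
Proof.
have sgn n' : \sum_(i < n'.+1) (-1) ^+ (n' - i) *+ 'C(n', i) = (0 == n')%N%:R :> R.
  have := exprDn (-1 : R) 1 n'; rewrite addNr expr0n.
  rewrite (eq_sym 0%N) => ->; apply: eq_bigr => i _.
  by rewrite expr1n mulr1.
elim: m n x => [n x _|m IHm n x mn].
  under eq_bigr do rewrite expr0 mulr1.
  by rewrite sgn; case: n => [|n]; rewrite ?fact0 ?mul1r ?mul0r.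
case: n mn => // n mn.
have -> : \sum_(i < n.+2) (-1) ^+ (n.+1 - i) * (x + i%:R) ^+ m.+1 *+ 'C(n.+1, i)
  = x * (\sum_(i < n.+2) (-1) ^+ (n.+1 - i) * (x + i%:R) ^+ m *+ 'C(n.+1, i))
   + n.+1%:R * (\sum_(i < n.+1) (-1) ^+ (n - i) * (x + 1 + i%:R) ^+ m *+ 'C(n, i)).
  have -> : n.+1%:R * (\sum_(i < n.+1) (-1) ^+ (n - i) * (x + 1 + i%:R) ^+ m *+ 'C(n, i))
    = \sum_(i < n.+2) i%:R * ((-1) ^+ (n.+1 - i) * (x + i%:R) ^+ m *+ 'C(n.+1, i)).
    rewrite [RHS]big_ord_recl mul0r add0r mulr_sumr; apply: eq_bigr => i _.
    rewrite lift0 subSS -addrA nat1r !mulr_natl -!mulrnA; congr (_ *+ _).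
    by rewrite mulnC mul_bin_diag mulnC.
  rewrite mulr_sumr -big_split; apply: eq_bigr => i _ /=.
  by rewrite -mulrDl exprS mulrCA mulrnAr.
rewrite IHm 1?ltnW// IHm// (ltn_eqF mn) mul0r mulr0 add0r eqSS mulrCA.
by rewrite factS natrM.
Qed.

Lemma poly_deriv_inj (R : numDomainType) (p q : {poly R}) :
  p^`() = q^`() -> p.[0] = q.[0] -> p = q.
Proof.
move=> pq pq0; apply/polyP => -[|i]; first by rewrite -!horner_coef0.
have := congr1 (fun r : {poly R} => r`_i) pq; rewrite !coef_deriv.
by move/(pmulrnI (ltn0Sn i)).
Qed.

(* Both sides, as polynomials in [y], satisfy F_(n+1)' = (n+1) F_n, and at [y = 0]
   the left-hand side is an n-th finite difference. *)
Lemma abel_identity (R : numDomainType) (n : nat) :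
  \sum_(i < n.+1) ((i%:R ^+ i)%:P * ('X - i%:R%:P) ^+ (n - i)) *+ 'C(n, i) =
  \sum_(j < n.+1) 'X^(n - j) *+ (n ^_ j) :> {poly R}.
Proof.
elim: n => [|n IHn].
  by rewrite !big_ord1 !expr0 mulr1.
apply: poly_deriv_inj.
  rewrite !raddf_sum /= [in LHS]big_ord_recr [in RHS]big_ord_recr /=.
  rewrite !subnn !expr0 mulr1 !derivMn derivC mul0rn addr0.
  rewrite -(@polyC1 R) derivC mul0rn addr0.
  transitivity ((\sum_(i < n.+1) ((i%:R ^+ i)%:P * ('X - i%:R%:P) ^+ (n - i))
      *+ 'C(n, i)) *+ n.+1 : {poly R}); last first.
    rewrite IHn -sumrMnl; apply: eq_bigr => i _.
    rewrite derivMn derivXn -!mulrnA subSn ?leq_ord//=.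
    by congr (_ *+ _); rewrite -subSn ?leq_ord// [RHS]mulnC -ffactnSr ffactSS mulnC.
  rewrite -sumrMnl; apply: eq_bigr => i _.
  rewrite derivMn derivM derivC mul0r add0r deriv_exp derivB derivX derivC subr0.
  rewrite mul1r subSn ?leq_ord//= mulrnAr -!mulrnA; congr (_ *+ _).
  by rewrite -subSn ?leq_ord// -mul_bin_down mulnC.
rewrite !horner_sum.
have := @alternating_binomial_sum_power R n.+1 n.+1 0 (leqnn _).
rewrite eqxx mul1r => E; transitivity (n.+1`!%:R : R).
  rewrite -E; apply: eq_bigr => i _.
  rewrite hornerMn hornerM hornerC horner_exp !hornerE; congr (_ *+ _).
  by rewrite (exprNn i%:R) mulrCA -exprD subnKC// leq_ord.
rewrite big_ord_recr /= big1 => [|i _]; last first.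
  by rewrite hornerMn hornerXn subSn ?leq_ord// expr0n mul0rn.
by rewrite add0r subnn hornerMn hornerXn expr0 ffactnn.
Qed.

(* Telescoping: (n ^_ j) / n ^ j drops by the fraction j / n at step j. *)
Lemma sum_ffact_ratio_le (R : realFieldType) (n c : nat) : (0 < n)%N -> (0 < c)%N ->
  \sum_(j < n.+1) (n ^_ j)%:R / n%:R ^+ j <= 1 + n%:R / c%:R + (c%:R - 1) / 2 :> R.
Proof.
move=> n0 c0; have nR : n%:R != 0 :> R by rewrite pnatr_eq0 -lt0n.
have n0R : 0 < n%:R :> R by rewrite ltr0n.
pose t j : R := (n ^_ j)%:R / n%:R ^+ j.
have t0 j : 0 <= t j by rewrite divr_ge0 ?exprn_ge0.
have tS j : j%:R * t j = n%:R * (t j - t j.+1).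
  rewrite /t; have [jn|jn] := leqP j n.
    rewrite ffactnSr natrM natrB// exprS; field.
    by rewrite nR expf_neq0.
  by rewrite !ffact_small ?ltnS ?(ltnW jn)// mulr0n !mul0r subrr !mulr0.
have t1 j : t j.+1 <= 1.
  elim: j => [|j IHj]; first by rewrite /t ffactn1 expr1 divff.
  apply: le_trans IHj; rewrite -subr_ge0 -(pmulr_rge0 _ n0R) -tS.
  by rewrite mulr_ge0.
have tel m : \sum_(j < m) j.+1%:R * t j.+1 = n%:R * (t 1%N - t m.+1).
  elim: m => [|m IHm]; first by rewrite big_ord0 subrr mulr0.
  by rewrite big_ord_recr /= IHm tS -mulrDr; congr (_ * _); ring.
have tn1 : t n.+1 = 0 by rewrite /t ffact_small// mulr0n mul0r.
have t11 : t 1%N = 1 by rewrite /t ffactn1 expr1 divff.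
have gauss m : \sum_(j < m) (c%:R - j.+1%:R : R) = c%:R * m%:R - m%:R * m.+1%:R / 2.
  elim: m => [|m IHm]; first by rewrite big_ord0; ring.
  by rewrite big_ord_recr /= IHm -[m.+2%:R]natr1 -[m.+1%:R]natr1; field.
rewrite big_ord_recl /= expr0 ffactn0 divr1 -addrA lerD2l.
under eq_bigr do rewrite /bump add1n -/(t _).
have c0R : 0 < c%:R :> R by rewrite ltr0n.
(* Split the factor [c] as [j + (c - j)]. The part weighted by [j] telescopes to [n]; as
   [0 <= t j <= 1], the part weighted by [c - j] is at most the sum of [c - j] over [j <= c]. *)
rewrite -(ler_pM2l c0R).
have -> : c%:R * (n%:R / c%:R + (c%:R - 1) / 2) = n%:R + c%:R * (c%:R - 1) / 2 :> R.
  by field; rewrite gt_eqF.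
have := tel n; rewrite tn1 t11 subr0 mulr1 => teln.
rewrite -lerBlDl -teln mulr_sumr -sumrB.
have -> : c%:R * (c%:R - 1) / 2 = \sum_(j < c) (c%:R - j.+1%:R) :> R.
  by rewrite gauss -natr1; field.
have pos j : (j < c)%N -> 0 <= c%:R - j.+1%:R :> R.
  by move=> jc; rewrite subr_ge0 ler_nat.
under eq_bigr do rewrite -mulrBl.
have [nc|cn] := leqP n c.
  rewrite -(big_mkord predT (fun j => (c%:R - j.+1%:R) * t j.+1)).
  rewrite -(big_mkord predT (fun j => c%:R - j.+1%:R)) (big_cat_nat _ nc)//=.
  rewrite -[leLHS]addr0 lerD//.
    rewrite !big_mkord; apply: ler_sum => j _.
    by rewrite ler_piMr ?pos// (leq_trans _ nc).
  by rewrite big_nat sumr_ge0// => j /andP[_ /pos].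
rewrite -(big_mkord predT (fun j => (c%:R - j.+1%:R) * t j.+1)).
rewrite (big_cat_nat _ (ltnW cn))//= -[leRHS]addr0 lerD//.
  rewrite !big_mkord; apply: ler_sum => j _.
  by rewrite ler_piMr ?pos.
rewrite big_nat; apply: sumr_le0 => j /andP[cj _].
by rewrite mulr_le0_ge0// subr_le0 ler_nat (leq_trans cj).
Qed.

(** Abel's identity evaluated at n and divided by n^n turns the sum into one of falling-factorial
    ratios; the telescoping bound is then used with [c] the integer part of 2 sqrt n. *)
Lemma maurer_sum_le (R : realType) (n : nat) : (0 < n)%N ->
  \sum_(i < n.+1) (i%:R / n%:R) ^+ i * ((n - i)%:R / n%:R) ^+ (n - i) *+ 'C(n, i)
  <= 2 * Num.sqrt n%:R :> R.
Proof.
move=> n0; have nR : n%:R != 0 :> R by rewrite pnatr_eq0 -lt0n.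
have -> : \sum_(i < n.+1)
    (i%:R / n%:R) ^+ i * ((n - i)%:R / n%:R) ^+ (n - i) *+ 'C(n, i) =
    \sum_(j < n.+1) (n ^_ j)%:R / n%:R ^+ j :> R.
  have := congr1 (fun p : {poly R} => p.[n%:R] / n%:R ^+ n) (abel_identity R n).
  rewrite !horner_sum !mulr_suml => E.
  transitivity (\sum_(i < n.+1) (((i%:R ^+ i)%:P * ('X - i%:R%:P) ^+ (n - i))
      *+ 'C(n, i)).[n%:R] / n%:R ^+ n : R).
    apply: eq_bigr => i _; rewrite hornerMn hornerM hornerC horner_exp !hornerE.
    rewrite !expr_div_n mulf_div -exprD subnKC ?leq_ord// -natrB ?leq_ord//.
    by rewrite mulrnAl.
  rewrite E; apply: eq_bigr => j _.
  rewrite hornerMn hornerXn -mulr_natl.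
  have -> : n%:R ^+ n = n%:R ^+ (n - j) * n%:R ^+ j :> R.
    by rewrite -exprD subnK// leq_ord.
  by field; rewrite !expf_neq0.
set u := Num.sqrt n%:R; have u1 : 1 <= u :> R.
  by rewrite -[leLHS]sqrtr1 ler_sqrt// ler1n.
have uu : n%:R = u ^+ 2 :> R by rewrite sqr_sqrtr.
have u2 : 0 <= 2 * u by lra.
have /andP[cl cu] := Num.Theory.truncn_itv u2; set c := Num.trunc _ in cl cu.
have c1 : (0 < c)%N by rewrite truncn_gt0; lra.
apply: le_trans (sum_ffact_ratio_le R n0 c1) _.
have c0R : 0 < c%:R :> R by rewrite ltr0n.
rewrite -natr1 in cu; rewrite uu -(ler_pM2l c0R).
have -> : c%:R * (1 + u ^+ 2 / c%:R + (c%:R - 1) / 2) =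
   c%:R + u ^+ 2 + c%:R * (c%:R - 1) / 2 :> R.
  by field; rewrite gt_eqF.
(* [c] lies between the roots of the quadratic because [2u-1] and [2u] do *)
have : (c%:R - (2 * u - 1)) * (c%:R - 2 * u) <= 0 :> R.
  by rewrite mulr_ge0_le0//; lra.
have : u * 1 <= u * u by rewrite ler_pM2l//; lra.
by rewrite !expr2 !mulrBl !mulrBr; nra.
Qed.

(** * The Basel bound *)

Section sin_le_id.
Import numFieldNormedType.Exports.

Lemma sin_le_id (R : realType) (x : R) : 0 <= x -> sin x <= x.
Proof.
move=> x0; have [->|xn0] := eqVneq x 0; first by rewrite sin0.
have {x0 xn0} x0 : 0 < x by rewrite lt_neqAle eq_sym xn0.
have [c _] := @MVT R sin cos 0 x x0 (fun y _ => is_derive_sin y)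
  (continuous_subspaceT (@continuous_sin R)).
by rewrite sin0 !subr0 => ->; rewrite ler_piMl ?(ltW x0)// cos_le1.
Qed.

End sin_le_id.

Lemma inv_sin2_double (R : realType) (x : R) : sin x != 0 -> cos x != 0 ->
  (sin x) ^- 2 + (cos x) ^- 2 = 4 * (sin (x *+ 2)) ^- 2.
Proof.
move=> s0 c0; rewrite sin_mulr2n -[_ *+ 2]mulr_natr.
have := cos2Dsin2 x; move: s0 c0; set s := sin x; set c := cos x => s0 c0 E.
have -> : s ^- 2 + c ^- 2 = (c ^+ 2 + s ^+ 2) / (s ^+ 2 * c ^+ 2).
  by field; rewrite s0 c0.
by rewrite E; field; rewrite s0 c0.
Qed.

Lemma big_pair_rev (R : nmodType) (F : nat -> R) (m : nat) :
  \sum_(k < m + m) F k = \sum_(k < m) (F k + F ((m + m) - k.+1)%N).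
Proof.
rewrite big_split_ord big_split /=; congr (_ + _).
rewrite (reindex_inj rev_ord_inj); apply: eq_bigr => k _ /=.
by rewrite addnBA.
Qed.

(* Hofbauer's proof of the Basel bound: the double-angle identity pairs the angles
   y and pi/2 - y of one level with the angle 2y of the previous level. *)
Lemma sum_inv_sin2_odd (R : realType) (n : nat) :
  \sum_(k < 2 ^ n) (sin (k.*2.+1%:R * pi / 2 ^+ n.+2 : R)) ^- 2 = 2 * 4 ^+ n.
Proof.
have pi0 := pi_gt0 R.
elim: n => [|n IHn].
  rewrite big_ord1 expr0 mulr1 mul1r.
  (* At pi/4 sine and cosine agree, so the double-angle identity determines the inverse square as
     2. *)
  have := @inv_sin2_double R (pi / 4).
  rewrite -[(pi / 4) *+ 2]mulr_natr (_ : pi / 4 * 2 = pi / 2); last by field.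
  rewrite sin_pihalf (_ : cos (pi / 4) = sin (pi / 4)); last first.
    by rewrite -cosBpihalf -cosN; congr cos; field.
  have s0 : 0 < sin (pi / 4 : R).
    by apply: sin_gt0_pihalf; apply/andP; split; lra.
  rewrite gt_eqF// => /(_ isT isT); rewrite (_ : 2 ^+ 2 = 4 :> R); last by ring.
  by rewrite expr1n invr1; lra.
rewrite expnS mul2n -addnn (big_pair_rev (fun k => (sin (k.*2.+1%:R * pi / 2 ^+ n.+3 : R)) ^- 2)).
rewrite [4 ^+ n.+1]exprS mulrCA -IHn mulr_sumr; apply: eq_bigr => k _.
have k2 : k.*2.+1%:R < 2 ^+ n.+1 :> R.
  rewrite -natrX ltr_nat expnS mul2n -doubleS (leq_trans _ (_ : k.+1.*2 <= _)%N)//.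
  by rewrite leq_double.
have p0 : 0 < 2 ^+ n.+1 :> R by rewrite exprn_gt0.
set y := k.*2.+1%:R * pi / 2 ^+ n.+3.
have y0 : 0 < y by rewrite !(mulr_gt0, invr_gt0, exprn_gt0).
have y1 : y < pi / 4.
  rewrite /y ltr_pdivrMr ?exprn_gt0// !exprS in k2 p0 *.
  by rewrite -mulrA mulrC; nra.
have -> : ((2 ^ n + 2 ^ n - k.+1).*2.+1)%:R * pi / 2 ^+ n.+3 = pi / 2 - y :> R.
  have -> : (2 ^ n + 2 ^ n - k.+1).*2.+1%:R = 2 ^+ n.+2 - k.*2.+1%:R :> R.
    rewrite -natrX -natrB; last first.
      by have := ltn_ord k; rewrite !expnS; lia.
    by congr (_%:R); have := ltn_ord k; rewrite !expnS; lia.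
  by rewrite /y !exprS; field; rewrite gt_eqF// exprn_gt0.
have -> : sin (pi / 2 - y) = cos y by rewrite -cosBpihalf -cosN; congr cos; ring.
rewrite inv_sin2_double.
- by congr (_ * (sin _) ^- 2); rewrite /y !exprS; field; rewrite gt_eqF// exprn_gt0.
- by rewrite gt_eqF// sin_gt0_pihalf//; apply/andP; split; lra.
- by rewrite gt_eqF// cos_gt0_pihalf//; apply/andP; split; lra.
Qed.

(** Padding to [2 ^ m] terms completes a level of the sine identity. There [sin y <= y] bounds each
    y^-2 by an inverse squared sine, and rescaling the angles turns the total [2 * 4 ^ m] into
    pi^2/8. *)
Lemma sum_inv_odd_square_le (R : realType) (m : nat) :
  \sum_(k < m) (k.*2.+1%:R ^- 2 : R) <= pi ^+ 2 / 8.
Proof.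
have pi0 := pi_gt0 R.
apply: (@le_trans _ _ (\sum_(k < 2 ^ m) (k.*2.+1%:R ^- 2))).
  rewrite -(big_mkord predT (fun k => k.*2.+1%:R ^- 2)).
  rewrite -(big_mkord predT (fun k => k.*2.+1%:R ^- 2)).
  rewrite [leRHS](big_cat_nat _ (ltnW (ltn_expl m (ltnSn 1))))//= lerDl.
  by apply: sumr_ge0 => k _; rewrite invr_ge0 exprn_ge0.
have p0 : 0 < 2 ^+ m :> R by rewrite exprn_gt0.
have c0 : 0 < (pi / 2 ^+ m.+2) ^- 2 :> R by rewrite invr_gt0 exprn_gt0 ?divr_gt0 ?exprn_gt0.
rewrite -(ler_pM2l c0).
have -> : (pi / 2 ^+ m.+2) ^- 2 * (pi ^+ 2 / 8) = 2 * 4 ^+ m :> R.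
  rewrite (_ : 4 ^+ m = 2 ^+ m ^+ 2 :> R); last by rewrite exprAC; congr (_ ^+ m); ring.
  by move: (pi : R) pi0 {c0} => q q0; rewrite !exprS; field; rewrite !gt_eqF.
rewrite -(sum_inv_sin2_odd R m) mulr_sumr; apply: ler_sum => k _.
rewrite -invfM -exprMn [_ * k.*2.+1%:R]mulrC mulrA.
set y := k.*2.+1%:R * pi / 2 ^+ m.+2.
have y0 : 0 < y by rewrite divr_gt0 ?exprn_gt0// mulr_gt0.
have k2 : k.*2.+1%:R < 2 ^+ m.+1 :> R.
  rewrite -natrX ltr_nat expnS mul2n -doubleS (leq_trans _ (_ : k.+1.*2 <= _)%N)//.
  by rewrite leq_double.
have y1 : y < pi / 2.
  rewrite /y ltr_pdivrMr ?exprn_gt0// !exprS in k2 *.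
  by rewrite -mulrA mulrC; nra.
have s0 : 0 < sin y by apply: sin_gt0_pihalf; rewrite y0.
have [y0' s0'] := (ltW y0, ltW s0).
by rewrite lef_pV2 ?posrE ?exprn_gt0// ler_sqr// sin_le_id.
Qed.

(** The even terms of [V m.*2] add up to [V m / 4], so [V m <= V m.*2] bounds three quarters of
    [V m] by the odd sum. *)
Lemma sum_inv_square_le (R : realType) (m : nat) :
  \sum_(k < m) (k.+1%:R ^- 2 : R) <= pi ^+ 2 / 6.
Proof.
pose V m : R := \sum_(k < m) k.+1%:R ^- 2.
have V2 : V m.*2 = \sum_(k < m) k.*2.+1%:R ^- 2 + V m / 4.
  elim: m => [|j IHj]; first by rewrite /V !big_ord0 mul0r addr0.
  rewrite doubleS /V !big_ord_recr /= -/(V j.*2) -/(V j) IHj.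
  have -> : j.*2.+2%:R ^- 2 = j.+1%:R ^- 2 / 4 :> R.
    rewrite -doubleS -mul2n natrM exprMn invfM mulrC.
    by congr (_ * _^-1); ring.
  move: (\sum_(k < j) _) (V j) (j.*2.+1%:R ^- 2) (j.+1%:R ^- 2) => A B C D'.
  by field.
have le_V : V m <= V m.*2.
  rewrite /V -(big_mkord predT (fun k => k.+1%:R ^- 2)).
  rewrite -(big_mkord predT (fun k => k.+1%:R ^- 2)).
  rewrite [leRHS](@big_cat_nat _ _ _ m) -?addnn ?leq_addr//= lerDl.
  by apply: sumr_ge0 => k _; rewrite invr_ge0 exprn_ge0.
by have := sum_inv_odd_square_le R m; rewrite V2 -/(V m) in le_V *; lra.
Qed.

(** * Binary divergence *)

(* For a, b > 0, [a * ln (a / b)] is the maximum over y of [a * ln y - b * y + a],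
   attained at y = a / b. *)
Lemma kl_term_le (R : realType) (a b : R) (C : \bar R) : 0 <= a -> 0 <= b ->
  (forall y, 0 < y -> ((a * ln y - b * y + a)%:E <= C)%E) -> (kl_term a b <= C)%E.
Proof.
move=> a0 b0 H; rewrite /kl_term.
case: C H => [c|//|/(_ _ ltr01)]; last 2 first.
- by rewrite leey.
- by rewrite leeNy_eq.
move=> H; case: eqVneq => [a_eq0|an0].
  rewrite lee_fin leNgt; apply/negP => c0.
  have b1 : 0 < b + 1 by lra.
  (* At this point the objective [- b * y] equals [c + y], which exceeds [c]; the shift [b + 1]
     covers [b = 0]. *)
  pose y := - c / (b + 1); have y0 : 0 < y by rewrite divr_gt0// oppr_gt0.
  have yE : (b + 1) * y = - c by rewrite /y; field; rewrite gt_eqF.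
  by have := H _ y0; rewrite a_eq0 mul0r sub0r addr0 lee_fin; lra.
have {an0} a_gt0 : 0 < a by rewrite lt_neqAle eq_sym an0.
case: eqVneq => [b_eq0|bn0].
  (* With [b = 0] the objective is unbounded; here it equals [c + a]. *)
  have := H _ (expR_gt0 (c / a)); rewrite expRK b_eq0 mul0r subr0 lee_fin.
  have -> : a * (c / a) = c by field; rewrite gt_eqF.
  by move=> ?; exfalso; lra.
have {bn0} b_gt0 : 0 < b by rewrite lt_neqAle eq_sym bn0.
have := H _ (divr_gt0 a_gt0 b_gt0).
by have -> : b * (a / b) = a by [field; rewrite gt_eqF]; rewrite addrNK.
Qed.

(** The hypothesis adds the variational forms of the two terms of [kl]. The suprema over [y1] and
    [y0] are taken one after the other, the second variable being frozen during the first. *)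
Lemma kl_le (R : realType) (q r : R) (C : \bar R) : 0 <= q <= 1 -> 0 <= r <= 1 ->
  (forall y1 y0, 0 < y1 -> 0 < y0 ->
    ((q * ln y1 + (1 - q) * ln y0 - (r * y1 + (1 - r) * y0 - 1))%:E <= C)%E) ->
  (kl q r <= C)%E.
Proof.
move=> /andP[q0 q1] /andP[r0 r1] H; rewrite /kl.
case: C H => [c|_|/(_ _ _ ltr01 ltr01)]; last 2 first.
- by rewrite leey.
- by rewrite leeNy_eq.
move=> H.
have t1 y0 : 0 < y0 ->
    (kl_term q r <= (c - ((1 - q) * ln y0 - (1 - r) * y0 + (1 - q)))%:E)%E.
  move=> y0_gt0; apply: kl_term_le => // y y_gt0.
  by have := H _ _ y_gt0 y0_gt0; rewrite !lee_fin; lra.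
case: (kl_term q r) t1 => [t|/(_ _ ltr01)//|_]; last by rewrite addNye leNye.
move=> t1; rewrite addeC -leeBrDr// -EFinB.
apply: kl_term_le => [||y y0]; [lra|lra|].
by have := t1 _ y0; rewrite !lee_fin; lra.
Qed.

Lemma kl_inv_ge (R : realType) (q r : R) (c : \bar R) :
  0 <= r <= 1 -> (kl q r <= c)%E -> r <= kl_inv q c.
Proof.
move=> r01 rc; apply: sup_upper_bound => //; split; first by exists r.
by exists 1 => s [/andP[]].
Qed.

(** * The Donsker-Varadhan inequality *)

Lemma integral_cst_probability d (T : measurableType d) (R : realType)
    (P : probability T R) (r : \bar R) : (\int[P]_x r = r)%E.
Proof.
transitivity (r * P setT)%E; first exact: integral_cst.
by rewrite probability_setT mule1.
Qed.

(** Positive and negative parts are compared separately, so [g] may have an infinite integral, as a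
    log-density does when the divergence is infinite. *)
Lemma le_integral_minorant d (T : measurableType d) (R : realType)
    (mu : {measure set T -> \bar R}) (f g : T -> \bar R) :
  mu.-integrable setT f -> measurable_fun setT g -> (forall x, (f x <= g x)%E) ->
  (\int[mu]_x f x <= \int[mu]_x g x)%E.
Proof.
move=> intf mg fg; have mf := measurable_int _ intf.
rewrite [leLHS]integralE [leRHS]integralE; apply: leeB.
  apply: ge0_le_integral => //; try exact: measurable_funepos.
  by move=> x _; apply: (@funepos_le _ _ setT f g); rewrite ?inE// => y _; exact: fg.
apply: ge0_le_integral => //; try exact: measurable_funeneg.
by move=> x _; apply: (@funeneg_le _ _ setT f g); rewrite ?inE// => y _; exact: fg.
Qed.

Lemma donsker_varadhan d (T : measurableType d) (R : realType)
    (Q P : probability T R) (u : T -> R) (t : R) :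
  measurable_fun setT u -> [bounded u x | x in setT] ->
  (\int[P]_x (expR (u x))%:E <= t%:E)%E ->
  (\int[Q]_x (u x)%:E <= KL Q P + (ln t)%:E)%E.
Proof.
move=> mu bu le_t; rewrite /KL; case: asboolP => [QP|_]; last by rewrite addye// leey.
have iu : Q.-integrable setT (EFin \o u).
  by apply: measurable_bounded_integrable => //; apply: fin_num_fun_lty.
(* [u] is bounded below, so its exponential moment under [P] is bounded away from 0; positivity of
   [t] is what gives [expR (ln t) = t]. *)
have t0 : 0 < t.
  have [M [Mreal /(_ (M + 1))]] := bu; rewrite ltrDl ltr01 => /(_ isT) uM.
  rewrite -lte_fin (lt_le_trans _ le_t)//.
  apply: (@lt_le_trans _ _ (\int[P]_x (cst (expR (- (M + 1)))%:E) x)%E).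
    by rewrite integral_cst_probability lte_fin expR_gt0.
  apply: ge0_le_integral => //.
  - by move=> x _; rewrite lee_fin expR_ge0.
  - apply/measurable_EFinP; exact: measurableT_comp.
  - move=> x _; rewrite /= lee_fin ler_expR lerNl.
    by rewrite (le_trans _ (uM x I))// -normrN ler_norm.
set c := ln t.
(* This version of the density is finite and nonnegative at every point; it agrees Q-almost
   everywhere with the one in [KL]. *)
pose F := Radon_Nikodym_SigmaFinite.f Q P.
pose f x := fine (F x).
have mF : measurable_fun setT F.
  exact: measurable_int (Radon_Nikodym_SigmaFinite.f_integrable QP).
have mf : measurable_fun setT f by apply/measurableT_comp.
have Ff x : F x = (f x)%:E.
  by rewrite fineK//; exact: Radon_Nikodym_SigmaFinite.f_fin_num.
have f0 x : 0 <= f x by rewrite fine_ge0//; exact: Radon_Nikodym_SigmaFinite.f_ge0.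
have mlnf : measurable_fun setT (fun x => ln (f x)).
  by apply: measurableT_comp => //; exact: measurable_ln.
have -> : (\int[Q]_x (ln (fine (Radon_Nikodym (charge_of_finite_measure Q) P x)))%:E
    = \int[Q]_x (ln (f x))%:E)%E.
  apply: ae_eq_integral => //.
  - apply/measurable_EFinP/measurableT_comp; first exact: measurable_ln.
    by apply/measurableT_comp => //; exact: measurable_int (Radon_Nikodym_integrable QP).
  - exact/measurable_EFinP.
  - apply: (null_dominates_ae_eq measurableT QP).
    have := ae_eq_Radon_Nikodym_SigmaFinite QP measurableT.
    by apply: filterS => x /(_ I) E _; rewrite /f /F E.
(* [phi] is [expR (u - c) / f] where f > 0, and is harmless where f = 0, a Q-null set;
   [expR v >= 1 + v] bounds [ln f] below by [u - c + 1 - phi] everywhere. *)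
pose phi x := expR (u x - c - ln (f x)).
have mphi : measurable_fun setT (fun x => (phi x)%:E).
  apply/measurable_EFinP/measurableT_comp => //; apply: measurable_funB => //.
  exact: measurable_funB.
have phi_le1 : (\int[Q]_x (phi x)%:E <= 1)%E.
  rewrite -(Radon_Nikodym_SigmaFinite.change_of_variables QP)//; last first.
    by move=> x; rewrite lee_fin expR_ge0.
  have le_int : (\int[P]_x ((phi x)%:E * F x) <= \int[P]_x ((t^-1)%:E * (expR (u x))%:E))%E.
    apply: ge0_le_integral => //.
    - by move=> x _; rewrite Ff lee_fin mulr_ge0// expR_ge0.
    - exact: emeasurable_funM.
    - apply: emeasurable_funM => //.
      by apply/measurable_EFinP/measurableT_comp.
    - move=> x _; rewrite Ff -!EFinM lee_fin /phi.
      have [->|fn0] := eqVneq (f x) 0.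
        by rewrite mulr0 mulr_ge0 ?expR_ge0// invr_ge0 ltW.
      rewrite expRB expRB /c !lnK ?posrE//; last by rewrite lt_neqAle eq_sym fn0 f0.
      by rewrite mulfVK// mulrC.
  apply: (le_trans le_int); rewrite ge0_integralZl//.
  - by rewrite -(@mulVf _ t) ?gt_eqF// EFinM lee_wpmul2l// lee_fin invr_ge0 ltW.
  - by apply/measurable_EFinP/measurableT_comp.
  - by rewrite lee_fin invr_ge0 ltW.
have iphi : Q.-integrable setT (EFin \o phi).
  apply/integrableP; split => //.
  under eq_integral do rewrite gee0_abs ?lee_fin ?expR_ge0//.
  by rewrite (le_lt_trans phi_le1)// ltry.
have ic : Q.-integrable setT (EFin \o cst (1 - c)) by exact: finite_measure_integrable_cst.
have iuc : Q.-integrable setT (fun x => (u x)%:E + (1 - c)%:E)%E by exact: integrableD.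
rewrite -leeBlDr//.
have igl : (\int[Q]_x ((u x)%:E + (1 - c)%:E - (phi x)%:E) <= \int[Q]_x (ln (f x))%:E)%E.
  apply: le_integral_minorant; [exact: integrableB|exact/measurable_EFinP|].
  move=> x; rewrite -!EFinD lee_fin /phi.
  by have := expR_ge1Dx (u x - c - ln (f x)); lra.
apply: le_trans igl; rewrite integralB// integralD// integral_cst_probability.
rewrite -addeA leeD2l// leeBrDr//; last first.
  exact: integrable_fin_num.
rewrite addeC EFinB; exact: leeD2r.
Qed.

(** * Integrals of functions with values in the unit interval *)

Lemma integrable_itv01 d (T : measurableType d) (R : realType)
    (Q : probability T R) (f : T -> R) :
  measurable_fun setT f -> (forall t, 0 <= f t <= 1) ->
  Q.-integrable setT (EFin \o f).
Proof.
move=> mf f01; apply: measurable_bounded_integrable => //.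
  exact: fin_num_fun_lty.
exists 1; split; first by rewrite num_real.
move=> y cy t _; have /andP[f0 f1] := f01 t; rewrite /= ger0_norm//.
by rewrite (le_trans f1)// ltW.
Qed.

Lemma Rintegral_itv01 d (T : measurableType d) (R : realType)
    (Q : probability T R) (f : T -> R) :
  measurable_fun setT f -> (forall t, 0 <= f t <= 1) -> 0 <= \int[Q]_t f t <= 1.
Proof.
move=> mf f01; rewrite Rintegral_ge0//=; last by move=> t _; case/andP: (f01 t).
rewrite -[leRHS]/(fine 1%E) -(integral_cst_probability Q 1%E).
apply: le_Rintegral => //.
- exact: integrable_itv01.
- by apply: (@integrable_itv01 _ _ _ _ (cst 1)) => // t; rewrite lexx ler01.
- by move=> t _; case/andP: (f01 t).
Qed.

(** * Likelihood ratios of binomial weights *)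

Section likelihood.
Context {R : realType} (N : nat).
Hypothesis N0 : (0 < N)%N.

(** The probability that a prescribed set of k samples, and no other sample, is misclassified; hence
    no binomial coefficient. *)
Definition binomial_weight (r : R) (k : nat) : R := r ^+ k * (1 - r) ^+ (N - k).

(* exp(N kl(k/N || r)); a vanishing denominator means that k errors have
   probability 0 under r. *)
Definition likelihood_ratio (k : nat) (r : R) : \bar R :=
  if binomial_weight r k == 0 then +oo%E
  else (binomial_weight (k%:R / N%:R) k / binomial_weight r k)%:E.

Lemma binomial_weight_ge0 r k : 0 <= r <= 1 -> 0 <= binomial_weight r k.
Proof. by move=> /andP[r0 r1]; rewrite mulr_ge0 ?exprn_ge0// subr_ge0. Qed.

Lemma empirical_mean_itv k : (k <= N)%N -> 0 <= (k%:R / N%:R : R) <= 1.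
Proof.
move=> kN; rewrite divr_ge0// ler_pdivrMr ?ltr0n// mul1r.
by rewrite ler_nat kN.
Qed.

Lemma likelihood_ratio_ge0 k r : (k <= N)%N -> 0 <= r <= 1 ->
  (0 <= likelihood_ratio k r)%E.
Proof.
move=> kN r01; rewrite /likelihood_ratio; case: ifPn => // _.
by rewrite lee_fin divr_ge0 ?binomial_weight_ge0// empirical_mean_itv.
Qed.

(** For [k > 0] this is the k-th power of [1 + x <= expR x] at [x = N v / k - 1], an equality at
    [v = k / N]. *)
Lemma expr_le_expR (v : R) (k : nat) : 0 <= v ->
  v ^+ k <= (k%:R / N%:R) ^+ k * expR (N%:R * v - k%:R).
Proof.
move=> v0; have NR : 0 < N%:R :> R by rewrite ltr0n.
case: k => [|k]; first by rewrite !expr0 mul1r subr0 -expR0 ler_expR mulr_ge0.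
have kR : 0 < k.+1%:R :> R by rewrite ltr0n.
have -> : N%:R * v - k.+1%:R = k.+1%:R * (N%:R * v / k.+1%:R - 1) :> R.
  by field; rewrite nat1r gt_eqF.
rewrite expRM_natl -exprMn lerXn2r ?nnegrE ?mulr_ge0 ?divr_ge0 ?expR_ge0//.
rewrite mulrC -ler_pdivrMr ?divr_gt0//.
apply: le_trans (expR_ge1Dx _).
by rewrite addrC subrK invf_div mulrA [v * _]mulrC.
Qed.

(** The product of the previous bound at [v = r * y1] and at [v = (1 - r) * y0]. The exponent is
    affine in [k] and [r]: it is the minorant later passed to [donsker_varadhan]. *)
Lemma expR_le_likelihood_ratio (k : nat) (r y1 y0 : R) :
  (k <= N)%N -> 0 <= r <= 1 -> 0 < y1 -> 0 < y0 ->
  ((expR (k%:R * ln y1 + (N - k)%:R * ln y0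
     - N%:R * (r * y1 + (1 - r) * y0 - 1)))%:E <= likelihood_ratio k r)%E.
Proof.
move=> kN r01 y10 y00; rewrite /likelihood_ratio.
case: ifPn => [_|w0]; first by rewrite leey.
have w_gt0 : 0 < binomial_weight r k by rewrite lt_neqAle eq_sym w0 binomial_weight_ge0.
rewrite lee_fin ler_pdivlMr// expRB expRD (expRM_natl _ (ln y1)) (expRM_natl _ (ln y0)).
rewrite !lnK ?posrE// mulrAC ler_pdivrMr ?expR_gt0//.
case/andP: r01 => r0 r1.
have le1 := @expr_le_expR (r * y1) k (mulr_ge0 r0 (ltW y10)).
have r1' : 0 <= 1 - r by rewrite subr_ge0.
have le0 := @expr_le_expR ((1 - r) * y0) (N - k) (mulr_ge0 r1' (ltW y00)).
have -> : y1 ^+ k * y0 ^+ (N - k) * binomial_weight r k =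
    (r * y1) ^+ k * ((1 - r) * y0) ^+ (N - k).
  by rewrite /binomial_weight !exprMn; ring.
apply: le_trans (ler_pM _ _ le1 le0) _; rewrite ?exprn_ge0 ?mulr_ge0 ?(ltW y10) ?(ltW y00)//.
rewrite mulrACA -expRD /binomial_weight.
have NR : N%:R != 0 :> R by rewrite pnatr_eq0 -lt0n.
have -> : 1 - k%:R / N%:R = (N - k)%:R / N%:R :> R.
  by rewrite natrB//; field.
rewrite le_eqVlt; apply/orP; left; apply/eqP; congr (_ * expR _).
by rewrite natrB//; ring.
Qed.

(** The weight cancels the denominator and leaves a function of the cardinality; grouping the sets
    by size restores the binomial coefficients of Maurer's sum. *)
Lemma sum_likelihood_ratio_le (r : R) : 0 <= r <= 1 ->
  (\sum_(s : {set 'I_N}) likelihood_ratio #|s| r * (binomial_weight r #|s|)%:E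
   <= (2 * Num.sqrt N%:R)%:E)%E.
Proof.
move=> r01.
pose m k : R := (k%:R / N%:R) ^+ k * ((N - k)%:R / N%:R) ^+ (N - k).
have NR : N%:R != 0 :> R by rewrite pnatr_eq0 -lt0n.
apply: (@le_trans _ _ (\sum_(s : {set 'I_N}) (m #|s|)%:E)%E).
  apply: lee_sum => s _.
  have sN : (#|s| <= N)%N by rewrite -[leqRHS]card_ord max_card.
  have m0 : 0 <= m #|s| by rewrite mulr_ge0 ?exprn_ge0 ?divr_ge0.
  (* A set of probability zero contributes [+oo * 0 = 0]. *)
  rewrite /likelihood_ratio; case: ifPn => [/eqP ->|w0]; first by rewrite mule0 lee_fin.
  rewrite -EFinM lee_fin mulfVK// /binomial_weight /m natrB//.
  by rewrite mulrBl divff.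
rewrite sumEFin lee_fin; apply: le_trans (maurer_sum_le R N0).
rewrite (partition_big (fun s : {set 'I_N} => inord #|s| : 'I_N.+1) predT)//=.
apply: ler_sum => k _.
have -> : 'C(N, k) = #|[set s : {set 'I_N} | #|s| == k]%SET|.
  by rewrite card_draws card_ord.
rewrite -/(m k) -sumr_const.
rewrite le_eqVlt; apply/orP; left; apply/eqP.
have sN (s : {set 'I_N}) : (#|s| < N.+1)%N by rewrite ltnS -[leqRHS]card_ord max_card.
apply: eq_big => s /=.
  by rewrite inE -val_eqE /= inordK.
by move=> /eqP <-; rewrite inordK.
Qed.

Lemma measurable_likelihood_ratio d (T : measurableType d) (f : T -> R) (k : nat) :
  measurable_fun setT f -> (forall x, 0 <= f x <= 1) ->
  measurable_fun setT (fun x => likelihood_ratio k (f x)).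
Proof.
move=> mf f01.
have mw : measurable_fun setT (fun x => binomial_weight (f x) k).
  apply: measurable_funM; apply: measurable_funX => //.
  exact: measurable_funB.
apply: measurable_fun_ifT => //.
  have m0 : measurable_fun [set: T] (fun _ => 0 : R) by [].
  exact: (measurable_fun_eqr mw m0).
apply/measurable_EFinP; apply: measurable_funM => //.
under eq_fun do rewrite -powR_inv1 ?binomial_weight_ge0//.
exact: (measurableT_comp (@measurable_powR R (-1)) mw).
Qed.

End likelihood.

(** * Empirical errors under a fixed prior *)

Section empirical_error.
Context {R : realType} d1 (T : measurableType d1) d2 (U : measurableType d2).
Context d3 (Omega : measurableType d3).
Variables (Pr : probability Omega R) (N : nat) (X : 'I_N -> {RV Pr >-> U}).
Variables (D : probability U R) (A : set (T * U)).
Hypothesis mA : measurable A.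
Hypothesis iidX : iid_samples X D.
Hypothesis N0 : (0 < N)%N.

Definition error_prob (t : T) : R := fine (D (xsection A t)).

(** Recording which samples fail, not only how many, makes each value of the set an intersection of
    one event per sample, to which independence applies directly. *)
Definition error_set (t : T) (w : Omega) : {set 'I_N} :=
  [set i | (t, X i w) \in A]%SET.

Definition evidence (t : T) (w : Omega) : \bar R :=
  likelihood_ratio N #|error_set t w| (error_prob t).

Lemma error_prob_itv t : 0 <= error_prob t <= 1.
Proof.
rewrite /error_prob fine_ge0//= -lee_fin fineK ?fin_num_measure//.
  exact: probability_le1 (measurable_xsection _ _).
exact: measurable_xsection.
Qed.

Lemma measurable_error_prob : measurable_fun setT error_prob.
Proof. by apply: measurableT_comp => //; exact: measurable_fun_xsection. Qed.

Let card_le (s : {set 'I_N}) : (#|s| <= N)%N.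
Proof. by rewrite -[leqRHS]card_ord max_card. Qed.

Lemma measurable_error_set s :
  measurable [set p : T * Omega | error_set p.1 p.2 = s].
Proof.
pose B i := [set p : T * Omega | (p.1, X i p.2) \in A].
have mB i : measurable (B i).
  have mf : measurable_fun [set: T * Omega] (fun p : T * Omega => (p.1, X i p.2)).
    by apply: measurable_fun_pair => //; exact: measurableT_comp.
  rewrite (_ : B i = [set: T * Omega] `&` (fun p => (p.1, X i p.2)) @^-1` A).
    exact: mf.
  by rewrite setTI; apply/seteqP; split => p /=; rewrite /B /= inE.
rewrite (_ : [set p | _] = \bigcap_(i in [set: 'I_N]) (if i \in s then B i else ~` B i)).
  apply: fin_bigcap_measurable => // i _; case: ifPn => // _.
  exact: measurableC.
apply/seteqP; split => [p /= ps i _|p H /=].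
  by rewrite -ps; case: ifPn; rewrite inE => // /negP.
apply/setP => i; have := H i I; rewrite inE.
case: ifPn => // _; rewrite /B /= => /negP/negbTE -> //.
Qed.

Lemma measurable_error_set_section t s : measurable [set w | error_set t w = s].
Proof.
have /measurable_xsection := measurable_error_set s.
move=> /(_ t); rewrite (_ : xsection _ t = [set w | error_set t w = s])//.
by apply/seteqP; split => w; rewrite /xsection /= inE.
Qed.

Lemma prob_error_set t s :
  Pr [set w | error_set t w = s] = (binomial_weight N (error_prob t) #|s|)%:E.
Proof.
have mAt : measurable (xsection A t) by exact: measurable_xsection.
pose C i := if i \in s then xsection A t else ~` xsection A t.
have mC i : measurable (C i) by rewrite /C; case: ifP => // _; exact: measurableC.
have -> : [set w | error_set t w = s] =
    \bigcap_(i in [set` [set: 'I_N]%SET]) (X i @^-1` C i).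
  apply/seteqP; split => [w /= ws i _|w H /=].
    by rewrite /C /= -ws inE; case: ifPn; rewrite /xsection/= => // /negP.
  apply/setP => i; have := H i; rewrite /= inE => /(_ isT); rewrite /C inE.
  by case: ifPn => // _ /negP/negbTE.
have [distX indX] := iidX; rewrite indX//.
under eq_bigr do rewrite (distX _ _ (mC _) : Pr _ = _).
have DA : D (xsection A t) = (error_prob t)%:E by rewrite fineK// fin_num_measure.
have DC i : D (C i) = (if i \in s then error_prob t else 1 - error_prob t)%:E.
  by rewrite /C; case: ifP => // _; rewrite probability_setC// DA EFinB.
under eq_bigr do rewrite DC.
rewrite prodEFin; congr _%:E.
rewrite (bigID (mem s))/= /binomial_weight; congr (_ * _).
  rewrite -prodr_const; apply: eq_big => i; first by rewrite inE.
  by rewrite inE => /andP[_ ->].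
rewrite (_ : (N - #|s|)%N = #|(~: s)%SET|); last by rewrite [in RHS]cardsCs finset.setCK card_ord.
rewrite -prodr_const; apply: eq_big => i; first by rewrite !inE.
by rewrite inE => /= /negbTE ->.
Qed.

(** A finite sum of functions of [t] times indicators: joint measurability and integration over the
    samples can be done term by term. *)
Lemma evidenceE t w : evidence t w =
  (\sum_(s : {set 'I_N}) likelihood_ratio N #|s| (error_prob t) *
     (\1_[set p : T * Omega | error_set p.1 p.2 = s] (t, w))%:E)%E.
Proof.
rewrite (bigD1 (error_set t w))//= big1 => [|s sE]; last first.
  by rewrite indicE memNset ?mule0// => /= E; rewrite E eqxx in sE.
by rewrite indicE mem_set// mule1 adde0.
Qed.

Lemma evidence_ge0 t w : (0 <= evidence t w)%E.
Proof. exact: likelihood_ratio_ge0 (card_le _) (error_prob_itv _). Qed.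

Lemma measurable_evidence :
  measurable_fun [set: T * Omega] (fun p => evidence p.1 p.2).
Proof.
under eq_fun do rewrite evidenceE.
apply: emeasurable_sum => s; apply: emeasurable_funM.
  apply: (measurable_likelihood_ratio N #|s|) => [|p]; last exact: error_prob_itv.
  by apply: (measurableT_comp measurable_error_prob).
apply/measurable_EFinP; under eq_fun do rewrite -surjective_pairing.
by apply: measurable_indic; exact: measurable_error_set.
Qed.

Lemma integral_evidence_le t :
  (\int[Pr]_w evidence t w <= (2 * Num.sqrt N%:R)%:E)%E.
Proof.
apply: le_trans (sum_likelihood_ratio_le N0 (error_prob_itv t)).
have lik0 (s : {set 'I_N}) : (0 <= likelihood_ratio N #|s| (error_prob t))%E.
  exact: likelihood_ratio_ge0 (card_le _) (error_prob_itv _).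
have mind (s : {set 'I_N}) : measurable_fun setT
    (fun w => (\1_[set p : T * Omega | error_set p.1 p.2 = s] (t, w))%:E : \bar R).
  apply/measurable_EFinP.
  rewrite (_ : (fun w => _) = \1_[set w | error_set t w = s]).
    by apply: measurable_indic; exact: measurable_error_set_section.
  by apply/funext => w; rewrite !indicE.
under eq_integral do rewrite evidenceE.
rewrite ge0_integral_sum//; last 2 first.
- by move=> s; exact: emeasurable_funM.
- by move=> s w _; rewrite mule_ge0// lee_fin indicE.
apply: lee_sum => s _; rewrite ge0_integralZl//.
rewrite -prob_error_set lee_wpmul2l//.
rewrite -[X in Pr X]setIT -integral_indic//; last exact: measurable_error_set_section.
Qed.

Definition bad_samples (P : probability T R) (a : R) : set Omega :=
  [set w | a%:E <= \int[P]_t evidence t w]%E.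

Lemma measurable_bad_samples P a : measurable (bad_samples P a).
Proof.
rewrite /bad_samples -[X in measurable X]setTI.
apply: emeasurable_fun_c_infty => //.
by apply: measurable_fun_fubini_tonelli_G measurable_evidence _ => p; exact: evidence_ge0.
Qed.

Lemma prob_bad_samples_le P a : 0 < a ->
  (Pr (bad_samples P a) <= (2 * Num.sqrt N%:R / a)%:E)%E.
Proof.
move=> a0.
have mM : measurable_fun setT (fun w => \int[P]_t evidence t w)%E.
  by apply: measurable_fun_fubini_tonelli_G measurable_evidence _ => p; exact: evidence_ge0.
have M0 w : (0 <= \int[P]_t evidence t w)%E.
  by apply: integral_ge0 => t _; exact: evidence_ge0.
have intM : (\int[Pr]_w \int[P]_t evidence t w <= (2 * Num.sqrt N%:R)%:E)%E.
  (* Tonelli puts the integral over samples inside, where the bound holds for each fixed [t]. *)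
  rewrite -(@fubini_tonelli _ _ _ _ _ P Pr (fun p => evidence p.1 p.2) measurable_evidence) => [|p]; last exact: evidence_ge0.
  rewrite -[leRHS](integral_cst_probability P); apply: ge0_le_integral => //.
  - by move=> t _; apply: integral_ge0 => w _; exact: evidence_ge0.
  - by apply: measurable_fun_fubini_tonelli_F measurable_evidence _ => p; exact: evidence_ge0.
  - by move=> t _; exact: integral_evidence_le.
(* Markov's inequality, from its version for nondecreasing functions applied to the identity. *)
have := @le_integral_comp_abse _ _ _ Pr setT measurableT
  (fun w => \int[P]_t evidence t w)%E a id (@measurable_id _ _ _) (fun r r0 => r0)
  (fun x y _ _ xy => xy) mM a0.
rewrite setTI (_ : [set w | _] = bad_samples P a); last first.
  by apply/seteqP; split => w /=; rewrite gee0_abs.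
under eq_integral do rewrite gee0_abs//.
move=> H; rewrite EFinM lee_pdivlMr// muleC.
exact: le_trans H intM.
Qed.

(** The bad event depends on [P] and [a] only, so one good [w] serves every [Q]. Integrating an
    affine minorant against [Q] gives the same affine function of the two mean risks, and the
    supremum over [y1] and [y0] is their [kl]. *)
Lemma kl_le_of_good_samples (P Q : probability T R) (a : R) (w : Omega) :
  ~ bad_samples P a w ->
  (kl (\int[Q]_t (N%:R^-1 * #|error_set t w|%:R)) (\int[Q]_t error_prob t)
   <= (N%:R^-1)%:E * (KL Q P + (ln a)%:E))%E.
Proof.
move=> /negP; rewrite -ltNge => /ltW M_le.
have NR : 0 < N%:R :> R by rewrite ltr0n.
have mK : measurable_fun setT (fun t => #|error_set t w|%:R : R).
  rewrite (_ : (fun t => _) = (fun t => \sum_(i < N) \1_A (t, X i w))).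
    apply: measurable_sum => i.
    apply: measurable_fun_pair1 => //; exact: measurable_indic.
  apply/funext => t; rewrite -sum1_card natr_sum big_mkcond; apply: eq_bigr => i _.
  by rewrite /error_set inE indicE; case: ifP.
have mr := measurable_error_prob.
have Kt t : 0 <= (N%:R^-1 * #|error_set t w|%:R : R) <= 1.
  by rewrite mulrC; apply: empirical_mean_itv => //; exact: card_le.
have mq : measurable_fun setT (fun t => N%:R^-1 * #|error_set t w|%:R : R).
  exact: measurable_funM.
have iq := integrable_itv01 Q mq Kt.
have ir := integrable_itv01 Q mr error_prob_itv.
apply: kl_le => [||y1 y0 y10 y00]; [exact: Rintegral_itv01|exact: Rintegral_itv01 error_prob_itv|].
set q := fun t => N%:R^-1 * #|error_set t w|%:R : R.
(* Coefficients of the exponent in [expR_le_likelihood_ratio], read as an affine function of the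
   error rate [q t] and of [error_prob t]. *)
pose al := N%:R * (ln y1 - ln y0); pose be := N%:R * (y1 - y0).
pose ga := N%:R * (ln y0 - y0 + 1).
pose u t := al * q t - be * error_prob t + ga.
have ia : Q.-integrable setT (EFin \o (fun t => al * q t)) by exact: (integrableZl measurableT al iq).
have ib : Q.-integrable setT (EFin \o (fun t => be * error_prob t)) by exact: (integrableZl measurableT be ir).
have iab : Q.-integrable setT (EFin \o (fun t => al * q t - be * error_prob t)).
  exact: (integrableB measurableT ia ib).
have ig : Q.-integrable setT (EFin \o (fun=> ga)) by exact: finite_measure_integrable_cst.
have iu : Q.-integrable setT (EFin \o u) by exact: (integrableD measurableT iab ig).
have mu : measurable_fun setT u.
  by apply: measurable_funD => //; apply: measurable_funB; exact: measurable_funM.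
have bu : [bounded u t | t in setT].
  exists (`|al| + `|be| + `|ga|); split; first by rewrite num_real.
  move=> M cM t _ /=; apply: le_trans (ltW cM); rewrite /u.
  have /andP[q0 q1] := Kt t; have /andP[r0 r1] := error_prob_itv t.
  apply: le_trans (ler_normD _ _) _; rewrite lerD2r.
  apply: le_trans (ler_normB _ _) _; rewrite (normrM al) (normrM be).
  by apply: lerD; apply: ler_piMr => //; rewrite ger0_norm.
have le_a : (\int[P]_t (expR (u t))%:E <= a%:E)%E.
  apply: le_trans M_le; apply: ge0_le_integral => //.
  - by apply/measurable_EFinP; exact: measurableT_comp.
  - exact: (@measurable_fun_pair1 _ _ _ _ _ _ (fun p => evidence p.1 p.2) w measurable_evidence).
  - move=> t _; rewrite /evidence.
    have := @expR_le_likelihood_ratio _ _ N0 _ _ _ _ (card_le (error_set t w))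
      (error_prob_itv t) y10 y00.
    congr (_ <= _)%E; congr (expR _)%:E.
    rewrite /u /q natrB ?card_le// /al /be /ga; field; rewrite gt_eqF//.
have := donsker_varadhan Q mu bu le_a.
have -> : (\int[Q]_t (u t)%:E = (\int[Q]_t u t)%:E)%E.
  by rewrite fineK//; exact: integrable_fin_num.
have -> : \int[Q]_t u t = al * \int[Q]_t q t - be * \int[Q]_t error_prob t + ga.
  rewrite (RintegralD measurableT iab ig) (RintegralB measurableT ia ib).
  rewrite (@RintegralZl _ _ _ Q setT q al measurableT iq).
  rewrite (@RintegralZl _ _ _ Q setT error_prob be measurableT ir); congr (_ + _).
  by rewrite /Rintegral integral_cst_probability.
move=> H; rewrite lee_pdivlMl// -EFinM.
rewrite [X in (X%:E <= _)%E](_ : _ = al * \int[Q]_t q t - be * \int[Q]_t error_prob t + ga)//.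
by rewrite /al /be /ga; ring.
Qed.

End empirical_error.

(** * Union bound over the priors *)

(** Since [lmax / lambda_j = expR (a_j / b)], the inner logarithm times [b] is the integer [a_j];
    the penalty is thus the logarithm of a Markov threshold. *)
Lemma ln_prior_weight (R : realType) (J : nat) (b c x : R) (a : 'I_J -> nat) (lmax : R) :
  0 < lmax -> 0 < b -> 0 < c -> 0 < x -> (forall j, (0 < a j)%N) ->
  \sum_(j < J) 2 * ln (b * ln (lmax / (lmax * expR (- ((a j)%:R / b)))))
    + J%:R * ln c + ln x = ln (x * \prod_(j < J) (c * (a j)%:R ^+ 2)).
Proof.
move=> l0 b0 c0 x0 a0; apply: expR_inj.
have aR j : 0 < (a j)%:R :> R by rewrite ltr0n.
have p0 : 0 < \prod_(j < J) (c * (a j)%:R ^+ 2).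
  by apply: prodr_gt0 => j _; rewrite mulr_gt0// exprn_gt0.
rewrite !expRD expRM_natl !lnK ?posrE ?mulr_gt0// mulrC; congr (_ * _).
rewrite expR_sum big_split /= prodr_const card_ord mulrC; congr (_ * _).
apply: eq_bigr => j _; rewrite (expRM_natl 2).
have -> : lmax / (lmax * expR (- ((a j)%:R / b))) = expR ((a j)%:R / b).
  rewrite expRN; field.
  by rewrite !gt_eqF ?expR_gt0.
by rewrite expRK mulrCA divff ?gt_eqF// mulr1 lnK ?posrE.
Qed.

(** The vectors are exhausted by the boxes [f j <= m]. On a box the sum of products factors into a
    product of sums, each at most 1; continuity from below passes to the union of all boxes. *)
Lemma weighted_union_bound (R : realType) d (Omega : measurableType d)
    (Pr : probability Omega R) (J : nat) (B : ('I_J -> nat) -> set Omega)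
    (v : nat -> R) (delta : R) :
  (forall f, measurable (B f)) -> (forall i, 0 <= v i) ->
  (forall m, \sum_(i < m) v i <= 1) -> 0 <= delta ->
  (forall f, (Pr (B f) <= (delta * \prod_(j < J) v (f j))%:E)%E) ->
  exists E : set Omega, [/\ measurable E, ((1 - delta)%:E <= Pr E)%E &
    forall w, E w -> forall f, ~ B f w].
Proof.
move=> mB v0 v1 delta0 PB.
pose U m := \big[setU/set0]_(f : {ffun 'I_J -> 'I_m.+1}) B (fun j => f j).
have mU m : measurable (U m) by exact: bigsetU_measurable.
have UP m w : U m w <-> exists2 f, (forall j, (f j <= m)%N) & B f w.
  rewrite /U -bigcup_seq; split => [[f _ Bf]|[f fm Bf]].
    by exists (fun j => f j : nat) => // j; rewrite -ltnS ltn_ord.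
  pose g : {ffun 'I_J -> 'I_m.+1} := [ffun j => inord (f j)].
  have gE : (fun j => g j : nat) = f by apply/funext => j; rewrite ffunE inordK ?ltnS.
  by exists g; rewrite /= ?mem_index_enum// gE.
have PU m : (Pr (U m) <= delta%:E)%E.
  apply: (@le_trans _ _ (\sum_(f : {ffun 'I_J -> 'I_m.+1}) Pr (B (fun j => f j)))%E).
    (* The induction carries measurability of the partial union along, as subadditivity requires
       it. *)
    apply: (@proj2 (measurable (U m))).
    rewrite /U; elim/big_rec2 : _ => [|f y A _ [mA PA]]; first by rewrite measure0.
    split; first exact: measurableU.
    by apply: le_trans (measureU2 _ (mB _) mA) _; exact: leeD2l.
  apply: (@le_trans _ _ (\sum_(f : {ffun 'I_J -> 'I_m.+1})
      (delta * \prod_(j < J) v (f j))%:E)%E); first by apply: lee_sum => f _; exact: PB.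
  rewrite sumEFin lee_fin -mulr_sumr -(bigA_distr_bigA (fun (j : 'I_J) (i : 'I_m.+1) => v i)).
  by rewrite ler_piMr// prodr_ile1// => j _; rewrite v1 sumr_ge0.
have mUU : measurable (\bigcup_m U m) by exact: bigcup_measurable.
exists (~` \bigcup_m U m); split; first exact: measurableC.
  rewrite probability_setC// EFinB leeB//.
  apply: cvge_le (nondecreasing_cvg_mu mU mUU _); first exact: nearW.
  move=> m n mn; apply/subsetPset => w /UP[f fm Bf]; apply/UP.
  by exists f => // j; rewrite (leq_trans (fm j)).
move=> w nU f Bf; apply: nU; exists (\max_(j < J) f j)%N => //; apply/UP.
by exists f => // j; exact: leq_bigmax.
Qed.

(** * The risks as posterior means of error probabilities and error rates *)

Section risk_identities.
Context {R : realType} (p d n N : nat).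
Variables (phi : n.-tuple R -> d.-tuple R -> R) (eps : R).
Variable zk : p.-tuple R -> d.-tuple R -> n.-tuple R.

Definition error_event : set (p.-tuple R * d.-tuple R) :=
  [set t | eps <= phi (zk t.1 t.2) t.2].

Hypothesis mphi : measurable_fun [set: p.-tuple R * d.-tuple R]
  (fun t => phi (zk t.1 t.2) t.2).

Lemma measurable_error_event : measurable error_event.
Proof.
rewrite (_ : error_event = [set: p.-tuple R * d.-tuple R] `&`
  (fun t => phi (zk t.1 t.2) t.2) @^-1` `[eps, +oo[%classic); first exact: mphi.
by rewrite setTI; apply/seteqP; split => t; rewrite /= in_itv /= andbT.
Qed.

Lemma errE t x : err phi eps zk t x = \1_error_event (t, x).
Proof. by rewrite /err indicE; congr ((nat_of_bool _)%:R); apply/idP/idP; rewrite inE. Qed.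

Lemma expected_riskE (D : probability (d.-tuple R) R) (Q : probability (p.-tuple R) R) :
  expected_risk phi eps zk D Q = \int[Q]_t error_prob D error_event t.
Proof.
apply: eq_Rintegral => t _; rewrite /error_prob /Rintegral; congr fine.
rewrite -[X in D X]setIT -integral_indic//; last first.
  exact: measurable_xsection measurable_error_event.
apply: eq_integral => x _; by rewrite errE !indicE mem_xsection.
Qed.

Lemma empirical_riskE disp (Omega : measurableType disp) (Pr : probability Omega R)
    (X : 'I_N -> {RV Pr >-> d.-tuple R}) (w : Omega) (Q : probability (p.-tuple R) R) :
  empirical_risk phi eps zk (fun i => X i w) Q =
  \int[Q]_t (N%:R^-1 * #|error_set X error_event t w|%:R).
Proof.
apply: eq_Rintegral => t _; congr (_ * _).
rewrite -sum1_card natr_sum [RHS]big_mkcond; apply: eq_bigr => i _.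
by rewrite /error_set inE errE indicE; case: ifP.
Qed.

End risk_identities.

(** The event [E] is fixed before [w], [s] and [a], so the bound holds simultaneously for all
    posteriors and all integer vectors. *)
Theorem theorem1 (R : realType) (p d n J N k : nat)
  (phi : n.-tuple R -> d.-tuple R -> R) (eps : R)
  (z : nat -> p.-tuple R -> d.-tuple R -> n.-tuple R)
  (grp : 'I_p -> 'I_J)
  (D : probability (d.-tuple R) R)
  (disp : measure_display) (Omega : measurableType disp)
  (Pr : probability Omega R) (X : 'I_N -> {RV Pr >-> d.-tuple R})
  (w0 : p.-tuple R) (lmax b delta : R) :
  (0 < N)%N ->
  measurable_fun [set: p.-tuple R * d.-tuple R]
    (fun t => phi (z k t.1 t.2) t.2) ->
  iid_samples X D ->
  0 < lmax -> 0 < b -> 0 < delta < 1 ->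
  exists E : set Omega,
    [/\ measurable E, ((1 - delta)%:E <= Pr E)%E &
      forall omega, E omega ->
      forall (w s : p.-tuple R) (a : 'I_J -> nat),
        (forall i, 0 <= tnth s i) -> (forall j, (0 < a j)%N) ->
        let Q := normal_diag (tnth w) (tnth s) in
        let lambda := fun j => lmax * expR (- ((a j)%:R / b)) in
        expected_risk phi eps (z k) D Q <=
          kl_inv (empirical_risk phi eps (z k) (fun i => X i omega) Q)
            (regularizer N grp w0 lmax b delta w s lambda)].
Proof.
move=> N0 mphi iidX l0 b0 /andP[d0 d1].
pose A := error_event phi eps (z k).
have mA : measurable A by exact: measurable_error_event.
have NR : 0 < N%:R :> R by rewrite ltr0n.
have sN : 0 < 2 * Num.sqrt N%:R :> R by rewrite mulr_gt0// sqrtr_gt0.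
pose c : R := pi ^+ 2 / 6.
have c0 : 0 < c by rewrite divr_gt0// exprn_gt0// pi_gt0.
pose lam (f : 'I_J -> nat) j := lmax * expR (- ((f j)%:R / b)).
pose prior f := normal_diag (tnth w0) (prior_variance grp (lam f)).
(* The Markov threshold: it gives the prior of [f] its share of [delta], and its logarithm is what
   [regularizer] adds to the divergence. *)
pose tau (f : 'I_J -> nat) := 2 * Num.sqrt N%:R / delta * \prod_(j < J) (c * (f j)%:R ^+ 2).
(* The union bound ranges over all naturals while the [a_j] are positive, hence the shift by one,
   undone at the end with [.-1]. *)
pose B (f : 'I_J -> nat) :=
  bad_samples X D A (prior (fun j => (f j).+1)) (tau (fun j => (f j).+1)).
pose v i : R := (c * i.+1%:R ^+ 2)^-1.
have v0 i : 0 <= v i by rewrite invr_ge0 mulr_ge0 ?exprn_ge0// ltW.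
have prod0 (f : 'I_J -> nat) : 0 < \prod_(j < J) (c * (f j).+1%:R ^+ 2).
  by apply: prodr_gt0 => j _; rewrite mulr_gt0// exprn_gt0// ltr0n.
have tau0 (f : 'I_J -> nat) : 0 < tau (fun j => (f j).+1).
  by rewrite mulr_gt0// divr_gt0.
have v1 m : \sum_(i < m) v i <= 1.
  under eq_bigr do rewrite /v invfM.
  by rewrite -mulr_sumr mulrC ler_pdivrMr// mul1r sum_inv_square_le.
have [] := @weighted_union_bound _ _ _ Pr J B v delta _ v0 v1 (ltW d0).
- by move=> f; exact: measurable_bad_samples.
- move=> f; apply: le_trans (prob_bad_samples_le mA iidX N0 _ (tau0 f)) _.
  rewrite lee_fin le_eqVlt; apply/orP; left; apply/eqP.
  by rewrite /v prodfV /tau; field; rewrite !gt_eqF ?sqrtr_gt0.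
move=> E [mE PE goodE]; exists E; split => // w Ew m s a s0 a0 /=.
set Q := normal_diag _ _.
rewrite expected_riskE// empirical_riskE//.
apply: kl_inv_ge.
  exact: Rintegral_itv01 (measurable_error_prob D mA) (error_prob_itv D mA).
apply: le_trans (kl_le_of_good_samples mA N0 Q (goodE w Ew (fun j => (a j).-1))) _.
rewrite /regularizer ln_prior_weight//; last first.
  by rewrite divr_gt0.
rewrite (_ : (fun j => (a j).-1.+1) = a)//.
by apply/funext => j; rewrite prednK.
Qed.
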